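(* The set $C_{\overline{D(P)_{\rm SP}},\Pi}:=\operatorname{conv}\{\Pi(u):\ u\in\overline{D(P)_{\rm SP}}\}\subseteq\mathbb{R}^M$ is a (possibly empty) polytope.
   Context: Let $T>0$, $p\in[1,\infty)$, $\sigma\in\mathbb{N}$, and let $P\subseteq\mathbb{R}_+^\sigma$ be a polytope. For $0\le t_1\le\cdots\le t_\sigma<\infty$ let $u_{t_1,\dots,t_\sigma}\in BV(0,T)$ be the function with $u_{t_1,\dots,t_\sigma}(t)=0$ if $|\{i\in\{1,\dots,\sigma\}: t_i\le t\}|$ is even and $u_{t_1,\dots,t_\sigma}(t)=1$ if this number is odd. Define $$D(P):=\{u_{t_1,\dots,t_\sigma}:\ (t_1,\ldots,t_\sigma)\in P,\ 0\le t_1\le\cdots\le t_\sigma<\infty\}.$$ Pointwise evaluation: every $u\in BV(0,T)$ has a unique right-continuous representative $\hat u$ on $(0,T)$; for $t\in(0,T)$, ''$u(t)=b$'' means $\hat u(t)=b$, and ''$u(0)=b$'' means $\lim_{t\searrow0}\hat u(t)=b$. Let fixings $(\tau_j,c_j)\in[0,T)\times\{0,1\}$, $j=1,\ldots,N$, with $\tau_1<\cdots<\tau_N$ be given and set $$D(P)_{\rm SP}:=\{u\in D(P):\ u(\tau_j)=c_j\ \text{for all } j=1,\ldots,N\}.$$ $\overline{D(P)_{\rm SP}}$ is its closure in $L^p(0,T)$. Let $I_i=(a_i,b_i)\subseteq(0,T)$, $i=1,\ldots,M$, be nonempty, pairwise disjoint open intervals with $\tau_j\notin I_i$ for all $i,j$,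 and let $\Pi$ be the local averaging operator $$\Pi(u)=\Big(\tfrac{1}{\lambda(I_i)}\int_{I_i}u(t)\,\mathrm{d}t\Big)_{i=1}^M\in\mathbb{R}^M,\qquad \lambda(I_i)=b_i-a_i.$$ *)

(* Defs.v *)
From HB Require Import structures.
From mathcomp Require Import all_boot all_order all_algebra.
From mathcomp Require Import all_classical all_reals all_analysis.

Set Implicit Arguments.
Unset Strict Implicit.
Unset Printing Implicit Defensive.

Import Order.TTheory GRing.Theory Num.Theory.
Import numFieldNormedType.Exports.

Local Open Scope classical_set_scope.
Local Open Scope ring_scope.

Definition conv_hull (R : numDomainType) (V : lmodType R) (S : set V) : set V :=
  smallest (@convex_set R V) S.

(* The empty set is a polytope (take [S = set0]). *)
Definition polytope (R : numDomainType) (V : lmodType R) (A : set V) : Prop :=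
  exists2 S : set V, finite_set S & A = conv_hull S.

Definition lebesgue_on (R : realType) (T : R) :
    {measure set (measurableTypeR R) -> \bar R} :=
  mrestr lebesgue_measure (measurable_itv `]0, T[ : measurable `]0, T[%classic).

(* L^p(0,T). Its elements are a.e.-classes and coerce to a measurable
   representative R -> R, whose values outside (0,T) are irrelevant. *)
Definition Lp (R : realType) (T p : R) (p1 : (1 <= p%:E)%E) : Type :=
  LspaceType (lebesgue_on T) p1.

Definition Lp_dist (R : realType) (T p : R) (p1 : (1 <= p%:E)%E)
    (u v : Lp T p1) : \bar R :=
  'N[lebesgue_on T]_p%:E [EFin \o (fun x => u x - v x)].

Definition Lp_closure (R : realType) (T p : R) (p1 : (1 <= p%:E)%E)
    (A : set (Lp T p1)) : set (Lp T p1) :=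
  [set u | forall e : R, 0 < e -> exists2 v, A v & (Lp_dist u v < e%:E)%E].

Definition switch (R : realType) (sigma : nat) (t : 'rV[R]_sigma) (x : R) : R :=
  (odd #|[pred i : 'I_sigma | t 0 i <= x]|)%:R.

Definition switch_times (R : realType) (sigma : nat) (t : 'rV[R]_sigma) : Prop :=
  (forall i, 0 <= t 0 i) /\
  (forall i j : 'I_sigma, (i <= j)%N -> t 0 i <= t 0 j).

Definition switch_set (R : realType) (T p : R) (p1 : (1 <= p%:E)%E) (sigma : nat)
    (P : set 'rV[R]_sigma) : set (Lp T p1) :=
  [set u | exists2 t, P t /\ switch_times t & u = switch t %[ae lebesgue_on T]].
Arguments switch_set {R} T {p} p1 {sigma} P.

Definition right_cont_rep (R : realType) (T p : R) (p1 : (1 <= p%:E)%E)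
    (u : Lp T p1) (v : R -> R) : Prop :=
  (forall x, x \in `]0, T[ -> v y @[y --> x^'+] --> v x) /\
  v = u %[ae lebesgue_on T].

(* "u(t) = b" for t in [0,T). The representative, when it exists, is unique on
   (0,T); classes without one (which cannot be in BV) have no point values. *)
Definition has_value (R : realType) (T p : R) (p1 : (1 <= p%:E)%E)
    (u : Lp T p1) (t b : R) : Prop :=
  exists2 v, right_cont_rep u v &
    if t == 0 then v x @[x --> 0^'+] --> b else v t = b.

Definition fixed_switch_set (R : realType) (T p : R) (p1 : (1 <= p%:E)%E) (sigma : nat)
    (P : set 'rV[R]_sigma) (N : nat) (tau : 'I_N -> R) (c : 'I_N -> bool) :
    set (Lp T p1) :=
  [set u | switch_set T p1 P u /\ forall j, has_value u (tau j) (c j)%:R].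
Arguments fixed_switch_set {R} T {p} p1 {sigma} P {N} tau c.

Definition local_avg (R : realType) (T p : R) (p1 : (1 <= p%:E)%E) (M : nat)
    (a b : 'I_M -> R) (u : Lp T p1) : 'rV[R]_M :=
  \row_i ((b i - a i)^-1 *
          \int[lebesgue_measure]_(t in `]a i, b i[) u t).

(* Main.v *)
(* Let [t] be the vector of switching times. Once it is known which [t_i] precede
   which fixing [tau_j], the values [u_t(tau_j)] are determined, so the fixings cut
   the admissible [t] into finitely many half-open polyhedral cells of [P]. If such
   a cell is nonempty, its closure is the polytope obtained by relaxing the strict
   inequalities, because the segment from a point of the closed cell to a point of
   the cell lies in the cell except for its end point. The average of [u_t] over an
   interval [(a, b)] is the alternating sum of the [b - clamp a b t_i], hence
   continuous and piecewise affine in [t]: the image of every closed cell has a hull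
   spanned by finitely many points. This hull is compact and the averages are
   continuous on L^p, so it contains the averages of all of the closure;
   conversely [t |-> u_t] is continuous into L^p, so every [t] in a closed cell is
   attained in the closure. *)
From HB Require Import structures.
Require Import Defs.
From mathcomp Require Import all_boot all_order all_algebra.
From mathcomp Require Import all_classical all_reals all_analysis.
From mathcomp Require Import measurable_realfun ring lra.

Set Implicit Arguments.
Unset Strict Implicit.
Unset Printing Implicit Defensive.

Import Order.TTheory GRing.Theory Num.Theory.
Import numFieldNormedType.Exports.

Local Open Scope classical_set_scope.
Local Open Scope ring_scope.

(** * Convex hulls of finite sets *)

Section ConvexHull.
Variables (R : realFieldType) (V : lmodType R).
Implicit Types (A S : set V).

Lemma convex_setP A : @convex_set R V A <->
  forall x y s, A x -> A y -> 0 <= s -> s <= 1 -> A (s *: x + (1 - s) *: y).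
Proof.
split=> [cA x y s Ax Ay s0 s1|cA x y s /set_mem Ax /set_mem Ay].
  have := cA x y (Itv01 s0 s1); rewrite !inE => /(_ Ax Ay).
  exact.
exact/mem_set/cA.
Qed.

Lemma conv_hull_convex S : @convex_set R V (conv_hull S).
Proof.
apply/convex_setP => x y s Sx Sy s0 s1 B [cB SB].
by move/convex_setP: (cB); apply => //; [exact: Sx|exact: Sy].
Qed.

Lemma conv_hull_sub S : S `<=` conv_hull S.
Proof. exact: sub_smallest. Qed.

Lemma conv_hull_min S A : @convex_set R V A -> S `<=` A -> conv_hull S `<=` A.
Proof. by move=> cA SA; exact: smallest_sub. Qed.

Lemma conv_hull_mono S A : S `<=` conv_hull A -> conv_hull S `<=` conv_hull A.
Proof. by move=> SA; apply: conv_hull_min => //; exact: conv_hull_convex. Qed.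

(** Induction over the index list on normalised partial sums: the new point enters with weight
    [w i / (w i + W)]. Membership in [A] is asked only where the weight is positive, so that indices
    of weight zero may carry arbitrary points. *)
Lemma convex_sum (I : finType) (w : I -> R) (v : I -> V) A :
  @convex_set R V A -> (forall i, 0 <= w i) -> (forall i, 0 < w i -> A (v i)) ->
  \sum_i w i = 1 -> A (\sum_i w i *: v i).
Proof.
move=> /convex_setP cA w0 wA.
have H (r : seq I) : 0 < \sum_(i <- r) w i ->
    A ((\sum_(i <- r) w i)^-1 *: \sum_(i <- r) w i *: v i).
  elim: r => [|i r IH]; first by rewrite big_nil ltxx.
  rewrite !big_cons; set W := \sum_(j <- r) w j; set X := \sum_(j <- r) _.
  have W0 : 0 <= W by apply: sumr_ge0.
  move=> wW.
  have [wi0|wi0] := eqVneq (w i) 0.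
    by move: wW; rewrite wi0 scale0r !add0r; exact: IH.
  have wip : 0 < w i by rewrite lt_neqAle eq_sym wi0 w0.
  have [W00|W00] := eqVneq W 0.
    have -> : X = 0.
      rewrite /X; move/eqP: W00; rewrite psumr_eq0 // => /allP r0.
      rewrite big_seq big1 // => j /r0 /eqP ->; exact: scale0r.
    by rewrite W00 !addr0 scalerA mulVf // scale1r; exact: wA.
  have Wp : 0 < W by rewrite lt_neqAle eq_sym W00 W0.
  have := cA _ _ (w i / (w i + W)) (wA _ wip) (IH Wp).
  rewrite divr_ge0 ?ler_pdivrMr ?(ltW wW) // mul1r lerDl W0 => /(_ isT isT).
  congr A; rewrite -/W -/X scalerDr !scalerA; congr (_ *: _ + _ *: _); first exact: mulrC.
  by field; rewrite W00 gt_eqF.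
by move=> w1; have := H (index_enum I); rewrite w1 ltr01 invr1 scale1r; exact.
Qed.

Lemma conv_hull_comb (I : finType) (v : I -> V) x :
  conv_hull (range v) x ->
  exists2 w : I -> R, (forall i, 0 <= w i) /\ \sum_i w i = 1 &
    x = \sum_i w i *: v i.
Proof.
pose C : set V := [set x | exists2 w : I -> R,
  (forall i, 0 <= w i) /\ \sum_i w i = 1 & x = \sum_i w i *: v i].
suff: conv_hull (range v) `<=` C by exact.
apply: conv_hull_min; last first.
  move=> _ [i _ <-]; exists (fun j => (i == j)%:R).
    split=> [j|]; first exact: ler0n.
    by rewrite (bigD1 i) //= eqxx big1 ?addr0 // => j /negbTE; rewrite eq_sym => ->.
  rewrite (bigD1 i) //= eqxx scale1r big1 ?addr0 // => j /negbTE.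
  by rewrite eq_sym => ->; rewrite scale0r.
apply/convex_setP => _ _ s [w [w0 w1] ->] [w' [w'0 w'1] ->] s0 s1.
exists (fun i => s * w i + (1 - s) * w' i).
  split=> [i|]; first by rewrite addr_ge0 // mulr_ge0 // subr_ge0.
  by rewrite big_split /= -!mulr_sumr w1 w'1 !mulr1 addrC subrK.
rewrite !scaler_sumr -big_split /=; apply: eq_bigr => i _.
by rewrite [RHS]scalerDl !scalerA.
Qed.

Lemma finite_range S : finite_set S ->
  exists (n : nat) (v : 'I_n -> V), S = range v.
Proof.
move/finite_seqP => [s ->]; exists (size s), (tnth (in_tuple s)).
apply/seteqP; split=> [x /= /(tnthP (in_tuple s))[i ->]|_ [i _ <-] /=].
  by exists i.
exact: (mem_tnth i (in_tuple s)).
Qed.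

End ConvexHull.

(** * Cutting a polytope by halfspaces *)

Section Halfspace.
Variables (R : realFieldType) (V : lmodType R).
Implicit Types (A S : set V) (l : V -> R).

Lemma scalar_sum l (I : finType) (w : I -> R) (v : I -> V) : scalar l ->
  l (\sum_i w i *: v i) = \sum_i w i * l (v i).
Proof.
move=> ll; have l0 : l 0 = 0.
  by have := ll (-1) 0 0; rewrite scaler0 addr0 mulN1r addNr.
by elim/big_rec2: _ => // i x y _ <-; rewrite ll.
Qed.

Lemma scalar_conv l x y s : scalar l ->
  l (s *: x + (1 - s) *: y) = s * l x + (1 - s) * l y.
Proof.
move=> ll; rewrite ll -[(1 - s) *: y]addr0 ll.
suff -> : l 0 = 0 by rewrite addr0.
by have := ll (-1) 0 0; rewrite scaler0 addr0 mulN1r addNr.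
Qed.

(* Where the segment from [x] (with [l x <= d]) to [y] (with [d < l y]) meets
   the hyperplane [l = d]. *)
Definition crossing l (d : R) (x y : V) : V :=
  ((l y - d) / (l y - l x)) *: x + (1 - (l y - d) / (l y - l x)) *: y.

(* Mass transport across the hyperplane: [e i] is the signed height of the
   [i]-th vertex, and every vertex above it ([~~ L j]) is paired with all the
   vertices below it ([L i]), proportionally to their depths. *)
Lemma transport_identity (U : lmodType R) (I : finType) (w e : I -> R)
    (L : pred I) (u : I -> U) (m D : R) :
  m = \sum_(j | ~~ L j) w j * e j -> D = \sum_(i | L i) w i * - e i -> D != 0 ->
  \sum_(i | L i) ((1 - m / D) * w i) *: u i +
  \sum_(i | L i) \sum_(j | ~~ L j)
    (w i * w j / D) *: (e j *: u i + (- e i) *: u j) = \sum_i w i *: u i.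
Proof.
move=> mE DE D0.
have -> : \sum_(i | L i) \sum_(j | ~~ L j)
    (w i * w j / D) *: (e j *: u i + (- e i) *: u j) =
  \sum_(i | L i) (m / D * w i) *: u i + \sum_(j | ~~ L j) w j *: u j.
  under eq_bigr do under eq_bigr do rewrite scalerDr.
  under eq_bigr do rewrite big_split.
  rewrite big_split /=; congr (_ + _).
    apply: eq_bigr => i _; rewrite mE -mulrA mulr_suml scaler_suml.
    apply: eq_bigr => j _.
    by rewrite scalerA; congr (_ *: _); ring.
  rewrite exchange_big /=; apply: eq_bigr => j _.
  under eq_bigr do rewrite scalerA.
  rewrite -scaler_suml; congr (_ *: _).
  rewrite -[RHS](divfK D0) [X in _ = _ * X]DE.
  by rewrite mulr_sumr; apply: eq_bigr => i _; ring.
rewrite addrA -big_split /= [RHS](bigID L) /=; congr (_ + _).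
apply: eq_bigr => i _; rewrite -scalerDl; congr (_ *: _); ring.
Qed.

(** The generators of the cut are the old generators inside the halfspace and the points where
    segments from an inner to an outer generator cross the hyperplane. A convex combination lying in
    the halfspace is rewritten over these by letting the inner generators absorb all the weight of
    the outer ones. *)
Lemma polytope_halfspace A l d : scalar l -> polytope A ->
  polytope (A `&` [set x | l x <= d]).
Proof.
move=> ll [S fS ->].
pose lo := S `&` [set x | l x <= d]; pose hi := S `&` [set x | d < l x].
pose S' := lo `|` [set crossing l d x y | x in lo & y in hi].
have cross x y : l x <= d -> d < l y ->
    [/\ 0 <= (l y - d) / (l y - l x) , (l y - d) / (l y - l x) <= 1 &
        l (crossing l d x y) = d].
  move=> xd dy; have xy : 0 < l y - l x by lra.
  split; first by rewrite divr_ge0 //; lra.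
    by rewrite ler_pdivrMr //; lra.
  by rewrite /crossing scalar_conv //; field; rewrite gt_eqF.
exists S'.
  rewrite finite_setU; split; first exact: finite_setIl.
  by apply: finite_image2; exact: finite_setIl.
apply/seteqP; split; last first.
  apply: conv_hull_min.
    apply/convex_setP => x y s [Sx xd] [Sy yd] s0 s1; split.
      by move/convex_setP: (@conv_hull_convex _ _ S); exact.
    by rewrite /= scalar_conv //; move: xd yd => /= xd yd; nra.
  move=> z [[Sz zd]|[x [Sx xd] [y [Sy dy] <-]]].
    by split=> //; exact: conv_hull_sub.
  have [c0 c1 cd] := cross _ _ xd dy; split; last by rewrite /= cd.
  by move/convex_setP: (@conv_hull_convex _ _ S); apply=> //; exact: conv_hull_sub.
have [n [v SE]] := finite_range fS.
have Sv i : S (v i) by rewrite SE; exists i.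
move=> x [+ /= xd]; rewrite {1}SE => /conv_hull_comb [w [w0 w1] xE].
pose L i := l (v i) <= d; pose e i := l (v i) - d.
pose m := \sum_(j | ~~ L j) w j * e j; pose D := \sum_(i | L i) w i * - e i.
(* [m] is the total height above the hyperplane and [D] the total depth below it. Their difference
   is [l x - d], which is nonpositive. *)
have hD : m <= D.
  rewrite -subr_le0 /m /D -sumrN addrC.
  under eq_bigr do rewrite mulrN opprK.
  rewrite -(bigID L xpredT (fun i => w i * e i)) /=.
  under eq_bigr do rewrite mulrBr.
  by rewrite sumrB -mulr_suml w1 mul1r -scalar_sum // -xE subr_le0.
have m0 j : ~~ L j -> 0 <= w j * e j.
  by rewrite /L -ltNge => jd; rewrite mulr_ge0 // /e; lra.
have mm : 0 <= m by exact: sumr_ge0.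
have loL i : L i -> S' (v i) by move=> Li; left; split.
(* With no depth below there is no height above either, so all the weight already sits on generators
   in the halfspace and no division by [D] is needed. *)
have [D0|D0] := eqVneq D 0.
  rewrite xE; apply: convex_sum => //; first exact: conv_hull_convex.
  move=> i wi; apply: conv_hull_sub; apply: loL; apply/negPn/negP => Li.
  have /eqP : m = 0 by apply/eqP; rewrite eq_le mm -D0 hD.
  rewrite psumr_eq0 // => /allP /(_ i (mem_index_enum _)).
  rewrite Li /= mulf_eq0 gt_eqF //= /e.
  by move: Li; rewrite /L -ltNge => dl /eqP; lra.
have Dp : 0 < D by rewrite lt_neqAle eq_sym D0 (le_trans mm).
(* The crossing of [v i] and [v j] is [(e j *: v i - e i *: v j) / (e j - e i)], hence the factor
   [e j - e i] in its weight. The inner generators keep the fraction [1 - m / D] of theirs,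
   nonnegative by [hD]. *)
pose W (k : 'I_n + 'I_n * 'I_n) := match k with
  | inl i => if L i then (1 - m / D) * w i else 0
  | inr (i, j) => if L i && ~~ L j then w i * w j / D * (e j - e i) else 0 end.
pose X (k : 'I_n + 'I_n * 'I_n) := match k with
  | inl i => v i | inr (i, j) => crossing l d (v i) (v j) end.
(* The target module is left free so that the identity serves twice: in [V] it gives [x], and in
   [R^o] with all vectors equal to 1 it gives the total weight. *)
have WE (U : lmodType R) (u : 'I_n -> U) (X' : 'I_n + 'I_n * 'I_n -> U) :
    (forall i, X' (inl i) = u i) ->
    (forall i j, L i -> ~~ L j ->
       (e j - e i) *: X' (inr (i, j)) = e j *: u i + (- e i) *: u j) ->
    \sum_k W k *: X' k = \sum_i w i *: u i.
  move=> X1 X2; rewrite -(@transport_identity _ _ w e L u m D) //.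
  rewrite big_sumType /=; congr (_ + _).
    rewrite [RHS]big_mkcond /=; apply: eq_bigr => i _.
    by case: ifP => _; rewrite ?scale0r // X1.
  rewrite [RHS]pair_big /= [RHS]big_mkcond /=; apply: eq_bigr => -[i j] _ /=.
  case: ifP => [/andP[Li Lj]|_]; last by rewrite scale0r.
  by rewrite -[LHS]scalerA X2.
have -> : x = \sum_k W k *: X k.
  rewrite xE; apply/esym/WE => // i j Li; rewrite /L -ltNge => Lj /=.
  rewrite /crossing scalerDr !scalerA; rewrite /L in Li.
  have h : l (v j) - l (v i) != 0 by rewrite gt_eqF //; lra.
  by congr (_ *: _ + _ *: _); rewrite /e; field.
apply: convex_sum.
- exact: conv_hull_convex.
- case=> [i|[i j]] /=; case: ifP => //.
    by move=> _; rewrite mulr_ge0 // subr_ge0 ler_pdivrMr // mul1r.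
  move=> /andP[]; rewrite /L -ltNge => Li Lj.
  by rewrite mulr_ge0 ?divr_ge0 ?mulr_ge0 ?(ltW Dp) // /e; lra.
- case=> [i|[i j]] /=; case: ifP; rewrite ?ltxx //.
    by move=> Li _; apply: conv_hull_sub; exact: loL.
  move=> /andP[]; rewrite /L -ltNge => Li Lj _; apply: conv_hull_sub; right.
  by exists (v i) => //; exists (v j).
- rewrite -w1; transitivity (\sum_k W k *: (1 : R^o)).
    by apply: eq_bigr => k _; rewrite /GRing.scale /= mulr1.
  rewrite (WE R^o (fun=> 1) (fun=> 1)) // => [|i j _ _].
    by apply: eq_bigr => k _; rewrite /GRing.scale /= mulr1.
  by rewrite /GRing.scale /= !mulr1.
Qed.

Lemma polytope_halfspaces A (I : finType) (l : I -> V -> R) (d : I -> R) :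
  (forall i, scalar (l i)) -> polytope A ->
  polytope (A `&` [set x | forall i, l i x <= d i]).
Proof.
move=> ll pA.
have H (r : seq I) : polytope (A `&` [set x | forall i, i \in r -> l i x <= d i]).
  elim: r => [|i r IH].
    by rewrite [X in _ `&` X](_ : _ = setT) ?setIT //; apply/seteqP; split.
  rewrite [X in polytope X](_ : _ =
    (A `&` [set x | forall i, i \in r -> l i x <= d i]) `&` [set x | l i x <= d i]).
    exact: polytope_halfspace.
  apply/seteqP; split=> x /= [].
    move=> Ax h; split; last by apply: h; rewrite inE eqxx.
    by split=> // j jr; apply: h; rewrite inE jr orbT.
  move=> [Ax h] hi; split=> // j; rewrite inE => /orP[/eqP -> //|]; exact: h.
have := H (enum I); congr (polytope (_ `&` _)).
apply/seteqP; split=> x /= h i; first by apply: h; rewrite mem_enum.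
by move=> _; exact: h.
Qed.

End Halfspace.

(** * Hulls of piecewise affine images *)

Section FinHulled.
Variables (R : realFieldType) (V W : lmodType R).
Implicit Types (A B S : set V) (f : V -> W).

(** The image of [A] need not be convex, so the property speaks of its hull only; this makes it
    stable under finite unions. Requiring [S] to lie in [A] makes every spanning point an actual
    value of [f] on [A]. *)
Definition fin_hulled f A :=
  exists2 S, finite_set S /\ S `<=` A & f @` A `<=` conv_hull (f @` S).

Definition affine_on A f := forall x y s, A x -> A y -> 0 <= s -> s <= 1 ->
  f (s *: x + (1 - s) *: y) = s *: f x + (1 - s) *: f y.

(** The points of [A] that [f] sends into the hull of the images of the generators form a convex
    set, by affinity, and this set contains the generators. *)
Lemma fin_hulled_affine f A : polytope A -> affine_on A f -> fin_hulled f A.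
Proof.
move=> [S fS AE] fA; exists S; first by rewrite AE; split=> //; exact: conv_hull_sub.
have cA : @convex_set R V A by rewrite AE; exact: conv_hull_convex.
have : A `<=` A `&` (f @^-1` conv_hull (f @` S)).
  rewrite {1}AE; apply: conv_hull_min.
    apply/convex_setP => x y s [Ax fx] [Ay fy] s0 s1; split.
      by move/convex_setP: cA; exact.
    rewrite /preimage /= fA //.
    by move/convex_setP: (@conv_hull_convex _ _ (f @` S)); exact.
  move=> x Sx; split; first by rewrite AE; exact: conv_hull_sub.
  by apply: conv_hull_sub; exists x.
by move=> h _ [x /h [_ fx] <-].
Qed.

Lemma fin_hulled_bigcup (I : finType) (Q : set I) (A : I -> set V) f :
  (forall i, Q i -> fin_hulled f (A i)) -> fin_hulled f (\bigcup_(i in Q) A i).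
Proof.
move=> H.
have /choice [S SP] : forall i, exists S, Q i ->
    (finite_set S /\ S `<=` A i) /\ f @` A i `<=` conv_hull (f @` S).
  move=> i; have [Qi|nQi] := pselect (Q i); last by exists set0.
  by have [S ? ?] := H i Qi; exists S.
exists (\bigcup_(i in Q) S i).
  split; last by apply: subset_bigcup => i /SP [[]].
  by apply: bigcup_finite => [|i /SP [[]]].
move=> _ [x [i Qi Aix] <-].
have [_ h] := SP i Qi; have : conv_hull (f @` S i) (f x) by apply: h; exists x.
apply: conv_hull_mono => _ [y Siy <-]; apply: conv_hull_sub.
by exists y => //; exists i.
Qed.

Lemma fin_hulledU f A B :
  fin_hulled f A -> fin_hulled f B -> fin_hulled f (A `|` B).
Proof.
move=> hA hB.
have -> : A `|` B = \bigcup_(b in [set: bool]) (if b then A else B).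
  apply/seteqP; split=> x; first by case; [exists true|exists false].
  by move=> [[] _]; [left|right].
by apply: fin_hulled_bigcup => -[].
Qed.

(** Each hyperplane of the list splits the polytope into two closed halves, again polytopes. After
    all cuts every piece lies on one side of each hyperplane, where [f] is assumed affine, and the
    pieces are reassembled by [fin_hulledU]. *)
Lemma fin_hulled_piecewise (r : seq ((V -> R) * R)) f A :
  (forall h, h \in r -> scalar h.1) -> polytope A ->
  (forall B, polytope B -> B `<=` A -> (forall h, h \in r ->
     (forall x, B x -> h.1 x <= h.2) \/ (forall x, B x -> h.2 <= h.1 x)) ->
     affine_on B f) ->
  fin_hulled f A.
Proof.
elim: r A => [|h r IH] A sr pA fA.
  by apply: fin_hulled_affine => //; apply: fA.
have AE : A = (A `&` [set x | h.1 x <= h.2]) `|` (A `&` [set x | - h.1 x <= - h.2]).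
  rewrite -setIUr; apply/seteqP; split=> [x Ax|x []//]; split=> //=.
  by rewrite lerN2; case: (leP (h.1 x) h.2) => [|/ltW]; [left|right].
have sh : scalar h.1 by apply: sr; rewrite inE eqxx.
have sr' : forall h, h \in r -> scalar h.1.
  by move=> k kr; apply: sr; rewrite inE kr orbT.
rewrite AE; apply: fin_hulledU; apply: IH => //.
- exact: polytope_halfspace.
- move=> B pB BA hB; apply: fA => // [x /BA []//|k].
  rewrite inE => /orP[/eqP ->|]; last exact: hB.
  by left=> x /BA [].
- apply: (@polytope_halfspace _ _ _ (fun x => - h.1 x)) => // a x y.
  by rewrite sh opprD mulrN.
- move=> B pB BA hB; apply: fA => // [x /BA []//|k].
  rewrite inE => /orP[/eqP ->|]; last exact: hB.
  by right=> x /BA [] /=; rewrite lerN2.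
Qed.

End FinHulled.

(** The hull is the continuous image of the standard simplex, which is the compact cube cut by the
    closed condition that the weights sum to 1. *)
Lemma compact_conv_hull (R : realType) (V : normedModType R) (S : set V) :
  finite_set S -> compact (conv_hull S).
Proof.
move=> /finite_range [n [v ->]].
pose simplex : set 'rV[R]_n :=
  [set w | forall i, 0 <= w 0 i <= 1] `&` [set w | \sum_i w 0 i = 1].
pose comb (w : 'rV[R]_n) : V := \sum_i w 0 i *: v i.
have -> : conv_hull (range v) = comb @` simplex.
  apply/seteqP; split=> [x /conv_hull_comb [w [w0 w1] ->]|_ [w [w01 w1] <-]].
    exists (\row_i w i); last by apply: eq_bigr => i _; rewrite mxE.
    split=> [i|/=]; last by rewrite -w1; apply: eq_bigr => i _; rewrite mxE.
    rewrite mxE w0 /= -w1 (bigD1 i) //= lerDl; exact: sumr_ge0.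
  apply: convex_sum => // [|i|i _].
  - exact: conv_hull_convex.
  - by have /andP[] := w01 i.
  - by apply: conv_hull_sub; exists i.
apply: continuous_compact.
  apply: continuous_subspaceT.
  apply: (continuous_big (@add_continuous V)) => i _ w.
  by apply: (@cvgZr_tmp _ _ _ (nbhs w)); exact: coord_continuous.
apply: compact_closedI.
  rewrite [X in compact X](_ : _ = [set w : 'rV[R]_n | forall i, `[0, 1]%classic (w 0 i)]).
    apply: (@rV_compact R n (fun=> `[0, 1]%classic)) => i; exact: segment_compact.
  by apply/seteqP; split=> w /= h i; have := h i; rewrite in_itv.
apply: (@preimage_closed _ _ (fun w : 'rV[R]_n => \sum_i w 0 i) [set 1]).
  have h := @continuous_big R 'I_n +%R 0 xpredT (@add_continuous R^o).
  by move=> w _; apply: h => i _; exact: coord_continuous.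
exact: closed_eq.
Qed.

Lemma conv_hull_finite_closed (R : realType) (M : nat) (S : set 'rV[R]_M)
    (y : 'rV[R]_M) :
  finite_set S ->
  (forall e, 0 < e -> exists2 x, conv_hull S x & forall i, `|y 0 i - x 0 i| < e) ->
  conv_hull S y.
Proof.
move=> /compact_conv_hull /(compact_closed (@norm_hausdorff _ _)) cS yS.
apply: cS => B /nbhs_ballP [e /= e0 yB].
have [x Sx xy] := yS _ e0; exists x; split=> //; apply: yB.
by split=> // i j; rewrite ord1; exact: xy.
Qed.

(** * Switching functions *)

(** A down-closed [q] is an initial segment, and the partial sums of 1 - 1 + 1 - ... are the
    parities of their lengths. In the induction, if the last index satisfies [q], then all indices
    do. *)
Lemma alternating_sum_downset (R : pzRingType) (n : nat) (q : pred 'I_n) :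
  (forall i j : 'I_n, (i <= j)%N -> q j -> q i) ->
  \sum_(i < n) (-1) ^+ i * (q i)%:R = (odd #|q|)%:R :> R.
Proof.
elim: n q => [|n IH] q dq.
  by rewrite big_ord0 (eq_card0 (A := q)) // => -[].
have qC : #|q| = (#|[pred i : 'I_n | q (widen_ord (leqnSn n) i)]| + q ord_max)%N.
  rewrite -!sum1_card big_mkcond /= big_ord_recr /= -big_mkcond /=.
  by congr addn; rewrite /in_mem /=; case: (q _).
rewrite big_ord_recr /= IH => [|i j ij]; last exact: dq.
rewrite qC oddD oddb; case qm: (q ord_max); last by rewrite mulr0 addr0 addbF.
rewrite (_ : #|_| = n); last first.
  rewrite -[RHS](card_ord n); apply: eq_card => i; rewrite !inE.
  by apply: dq qm; rewrite /= ltnW.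
by rewrite mulr1 addbT -signr_odd; case: (odd n); rewrite /= ?expr1 ?expr0 ?subrr ?add0r.
Qed.

Definition heaviside (R : realType) (s x : R) : R := (s <= x)%R%:R.

Section Switch.
Variables (R : realType) (sigma : nat).
Implicit Types (t : 'rV[R]_sigma) (x s : R).

Lemma heaviside_indic s : heaviside s = \1_(`[s, +oo[%classic).
Proof.
by apply/funext => x; rewrite /heaviside indicE mem_setE in_itv /= andbT.
Qed.

Lemma measurable_heaviside s (D : set R) : measurable_fun D (heaviside s).
Proof. by rewrite heaviside_indic; exact: measurable_indic. Qed.

Lemma heaviside_norm s x : `|heaviside s x| <= 1.
Proof. by rewrite /heaviside normr_nat lern1 leq_b1. Qed.

(** Sortedness makes the switchings before [x] an initial segment. The parity thus becomes a linear
    combination of step functions, which can be integrated and estimated term by term. *)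
Lemma switchE t : switch_times t ->
  switch t = fun x => \sum_(k < sigma) (-1) ^+ k * heaviside (t 0 k) x.
Proof.
move=> [_ tm]; apply/funext => x; rewrite /switch /heaviside.
rewrite (alternating_sum_downset R (q := fun k => t 0 k <= x)) // => i j ij.
exact: le_trans (tm _ _ ij).
Qed.

Lemma switch_norm t x : `|switch t x| <= 1.
Proof. by rewrite /switch normr_nat lern1 leq_b1. Qed.

Lemma measurable_switch t (D : set R) : switch_times t -> measurable_fun D (switch t).
Proof.
move=> /switchE ->; apply: measurable_sum => k.
by apply: measurable_funM => //; exact: measurable_heaviside.
Qed.

(** Each comparison [t 0 k <= y] keeps its truth value for [y] slightly to the right of [x], so the
    function is locally constant there. *)
Lemma switch_right_cont t x : switch t y @[y --> x^'+] --> switch t x.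
Proof.
apply: cvg_near_cst.
have H : \forall y \near x^'+, forall k, (t 0 k <= y) = (t 0 k <= x).
  apply: filter_forall => k.
  have [tx|tx] := leP (t 0 k) x.
    by near=> y; apply: (le_trans tx); near: y; exact: nbhs_right_ge.
  by near=> y; apply/negbTE; rewrite -ltNge; near: y; exact: nbhs_right_lt.
apply: filterS H => y H; rewrite /switch; congr (odd _)%:R.
by apply: eq_card => k; rewrite !inE.
Unshelve. all: by end_near. Qed.

(* [switch] takes the values 0 and 1 only, so [|d| `^ p = |d|] for differences. *)
Lemma powR_switch_dist t t' x (p : R) : switch_times t -> switch_times t' -> 0 < p ->
  `|switch t x - switch t' x| `^ p <= \sum_k `|heaviside (t 0 k) x - heaviside (t' 0 k) x|.
Proof.
move=> tt tt' p0; apply: (@le_trans _ _ `|switch t x - switch t' x|).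
  rewrite /switch; do 2 case: (odd _) => /=;
    by rewrite ?subrr ?subr0 ?sub0r ?normrN ?normr1 ?normr0 ?powR1 ?powR0 ?gt_eqF.
rewrite !switchE // -sumrB; apply: (le_trans (ler_norm_sum _ _ _)).
by apply: ler_sum => k _; rewrite -mulrBr normrM normrX normrN1 expr1n mul1r.
Qed.

End Switch.

(** * Integrals and distances in L^p(0,T) *)

Section LebesgueOn.
Variables (R : realType) (T p : R) (p1 : (1 <= p%:E)%E).
Hypothesis T0 : 0 < T.
Local Notation mu := (lebesgue_on T).
Local Notation Lp := (Lp T p1).

#[local] Instance ae_filter_lebesgue_on : Filter (nbhs (almost_everywhere mu)).
Proof. exact: ae_filter_ringOfSetsType. Qed.

Lemma lebesgue_on_setT : mu [set: measurableTypeR R] = T%:E.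
Proof.
rewrite /lebesgue_on /= /mrestr setTI lebesgue_measure_itv /= lte_fin T0.
by rewrite sube0.
Qed.

Lemma lebesgue_on_le A : measurable A -> (mu A <= lebesgue_measure A)%E.
Proof.
move=> mA; rewrite /lebesgue_on /= /mrestr; apply: le_measure; rewrite ?inE //.
exact: measurableI.
Qed.

Lemma Rintegral_lebesgue_on D (f : R -> R) : D `<=` `]0, T[%classic ->
  \int[lebesgue_measure]_(x in D) f x = \int[mu]_(x in D) f x.
Proof.
move=> DT; congr fine; apply: eq_measure_integral => A mA AD.
by rewrite /lebesgue_on /= /mrestr setIidl //; exact: subset_trans DT.
Qed.

(** For [p > 1], Hoelder against the constant 1, whose norm for the conjugate exponent [q] is [T] to
    the power [1/q]. *)
Lemma Lnorm1_le_Lnorm : exists2 C : R, 0 < C &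
  forall f : measurableTypeR R -> R, measurable_fun setT f ->
    ('N[mu]_1%:E[EFin \o f] <= C%:E * 'N[mu]_p%:E[EFin \o f])%E.
Proof.
have : 1 <= p by rewrite -lee_fin.
rewrite le_eqVlt => /orP[/eqP <-|p_gt1].
  by exists 1 => // f _; rewrite mul1e.
pose q := (1 - p^-1)^-1.
have q0 : 0 < q by rewrite invr_gt0 subr_gt0 invf_lt1 // (lt_trans ltr01).
exists (T `^ q^-1); first exact: powR_gt0.
move=> f mf.
have := @hoelder _ _ _ mu f (cst 1) p q mf (@measurable_cst _ _ _ _ _ _).
rewrite (lt_trans ltr01) // q0 => /(_ isT isT).
rewrite /q invrK subrKC => /(_ erefl).
rewrite (_ : EFin \o (f \* cst 1) = EFin \o f); last first.
  by apply/funext => x /=; rewrite mulr1.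
move=> /le_trans -> //.
rewrite (_ : EFin \o cst 1 = cst 1%E) // Lnorm_cst1 lebesgue_on_setT muleC.
by rewrite invrK.
Qed.

Lemma measurable_Lp (u : Lp) : measurable_fun setT (u : R -> R).
Proof.
have : measurable_fun [set: measurableTypeR R] (u : measurableTypeR R -> measurableTypeR R).
  exact: measurable_funPT.
exact.
Qed.

Lemma integrable_Lp (u : Lp) : mu.-integrable setT (EFin \o u).
Proof.
apply/Lfun1_integrable.
apply: (@Lfun_subset _ _ _ mu 1 p%:E) => //; first by rewrite lebesgue_on_setT.
rewrite inE; apply/andP; split; rewrite inE /=; first exact: measurable_Lp.
exact: Lebesgue_finite.
Qed.

(** The integral over [D] is bounded by the 1-norm, hence by the p-norm. The constant is chosen
    before [D], so that it serves all averaging intervals at once. *)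
Lemma Rintegral_Lp_dist : exists2 C : R, 0 < C &
  forall (u v : Lp) D, measurable D -> D `<=` `]0, T[%classic ->
  (`| \int[lebesgue_measure]_(x in D) u x - \int[lebesgue_measure]_(x in D) v x|%:E
     <= C%:E * Lp_dist u v)%E.
Proof.
have [C C0 CP] := Lnorm1_le_Lnorm; exists C => // u v D mD DT.
have muv : measurable_fun setT (fun x : measurableTypeR R => u x - v x).
  by apply: measurable_funB; exact: measurable_Lp.
have iS w : mu.-integrable D (EFin \o (w : Lp)).
  by apply: (integrableS measurableT) => //; exact: integrable_Lp.
rewrite !Rintegral_lebesgue_on // -RintegralB //.
have iuv : mu.-integrable D (EFin \o (fun x => u x - v x)).
  rewrite (_ : _ \o _ = (EFin \o u) \- (EFin \o v))%E //.
  exact: integrableB.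
apply: le_trans (CP _ muv); rewrite Lnorm1.
rewrite EFin_normr_Rintegral //.
apply: (le_trans (le_abse_integral _ _ _)) => //.
  by case/integrableP : iuv.
apply: ge0_subset_integral => //.
by apply/measurable_EFinP; exact: measurableT_comp.
Qed.

(** Used both to show that bounded functions have finite norm and to estimate the distance of two
    switching functions. *)
Lemma Lnorm_le_integral (f g : measurableTypeR R -> R) (c : R) :
  measurable_fun setT f -> measurable_fun setT g -> (forall x, 0 <= g x) ->
  (\forall x \ae mu, `|f x| `^ p <= g x) ->
  (\int[mu]_x (g x)%:E <= c%:E)%E ->
  ('N[mu]_p%:E[EFin \o f] <= (c `^ p^-1)%:E)%E.
Proof.
move=> mf mg g0 fg gc.
have p0 : 0 < p by rewrite (lt_le_trans ltr01) // -lee_fin.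
rewrite unlock /Lnorm -poweR_EFin.
have mfp : measurable_fun setT (fun x => (`|f x| `^ p)%:E).
  apply/measurable_EFinP; apply: (@measurableT_comp _ _ _ _ _ _ (@powR R ^~ p)) => //.
  exact: measurableT_comp.
have h : (\int[mu]_x (`|f x| `^ p)%:E <= c%:E)%E.
  apply: le_trans gc; apply: ae_ge0_le_integral => //.
  - by move=> x _; rewrite lee_fin.
  - exact/measurable_EFinP.
  - by apply: filterS fg => x fgx _; rewrite lee_fin.
have h0 : (0 <= \int[mu]_x (`|f x| `^ p)%:E)%E.
  by apply: integral_ge0 => x _; rewrite lee_fin powR_ge0.
rewrite (gt0_ler_poweR (ltW _)) ?invr_gt0 ?in_itv //= ?h0 ?leey //.
by rewrite (le_trans h0 h).
Qed.

Lemma Lp_ae_ex (f : R -> R) : measurable_fun setT f -> (forall x, `|f x| <= 1) ->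
  exists u : Lp, u = f %[ae mu].
Proof.
move=> mf f1.
have mf' : @measurable_fun _ _ (measurableTypeR R) (measurableTypeR R) setT f.
  exact: mf.
pose fB := isMeasurableFun.Build _ _ (measurableTypeR R) (measurableTypeR R) f mf'.
pose F : {mfun measurableTypeR R >-> measurableTypeR R} :=
  HB.pack_for {mfun measurableTypeR R >-> measurableTypeR R} f fB.
(* The representative chosen in the class of [f] agrees with [f] only almost everywhere, so the
   bound by 1 is also transferred almost everywhere. *)
pose g : {mfun_ mu, measurableTypeR R >-> measurableTypeR R} :=
  \pi_({mfun_ mu, measurableTypeR R >-> measurableTypeR R})%qT F.
have gf : (g : R -> R) = f %[ae mu].
  have : (repr g == F %[mod {mfun_ mu, measurableTypeR R >-> measurableTypeR R}])%qT.
    by rewrite reprK.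
  by rewrite eqmodE => /asboolP.
have gfin : finite_norm mu p%:E g.
  apply: (@le_lt_trans _ _ (T `^ p^-1)%:E); last exact: ltry.
  apply: (@Lnorm_le_integral _ (cst 1)) => //.
  - exact: (measurable_funPT (repr g)).
  - apply: (@filterS R _ ae_filter_lebesgue_on _ _ _ gf) => x /(_ Logic.I) ->; rewrite /=.
    have -> : 1 = 1 `^ p by rewrite powR1.
    apply: ge0_ler_powR; rewrite ?nnegrE //.
    by rewrite (@le_trans _ _ 1) // -lee_fin.
  - rewrite [leLHS](_ : _ = \int[mu]_x cst 1%E x)%E //.
    by rewrite integral_cst // lebesgue_on_setT mul1e.
pose gB := isFinLebesgue.Build _ _ _ mu p%:E p1 g gfin.
exists (HB.pack_for Lp g gB).
exact: gf.
Qed.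

(** For [s <= s'] the two step functions differ exactly on [[s, s'[]. *)
Lemma integral_heaviside_dist s s' :
  (\int[mu]_x (`|heaviside s x - heaviside s' x|)%:E <= `|s - s'|%:E)%E.
Proof.
wlog ss' : s s' / s <= s'.
  move=> h; have [|/ltW] := leP s s'; first exact: h.
  by move=> /h; rewrite distrC; under eq_integral do rewrite distrC.
rewrite (_ : (fun x => _) = fun x => (\1_(`[s, s'[%classic) x)%:E); last first.
  apply/funext => x; rewrite indicE mem_setE in_itv /= /heaviside; congr EFin.
  have [sx|sx] := leP s x; have [sx'|sx'] := leP s' x;
    rewrite /= ?subrr ?subr0 ?normr0 ?normr1 //.
  by have := lt_le_trans sx (le_trans ss' sx'); rewrite ltxx.
rewrite integral_indic //= setIT; apply: (le_trans (lebesgue_on_le _)) => //.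
rewrite lebesgue_measure_itv /= lte_fin distrC ger0_norm ?subr_ge0 //.
by case: ifP => //; rewrite lee_fin subr_ge0.
Qed.

(** Continuity of [t |-> u_t] into L^p: the p-th power of the difference is dominated by the sum of
    the step function differences, each of integral at most [|t_k - t'_k|]. *)
Lemma Lp_dist_switch sigma (t t' : 'rV[R]_sigma) (u v : Lp) :
  switch_times t -> switch_times t' ->
  u = switch t %[ae mu] -> v = switch t' %[ae mu] ->
  (Lp_dist u v <= ((\sum_k `|t 0 k - t' 0 k|) `^ p^-1)%:E)%E.
Proof.
move=> tt tt' ut vt'.
have p0 : 0 < p by rewrite (lt_le_trans ltr01) // -lee_fin.
have mh k : measurable_fun [set: measurableTypeR R]
    (fun x => `|heaviside (t 0 k) x - heaviside (t' 0 k) x|).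
  by apply: measurableT_comp => //; apply: measurable_funB; exact: measurable_heaviside.
apply: (@Lnorm_le_integral _
  (fun x => \sum_k `|heaviside (t 0 k) x - heaviside (t' 0 k) x|)).
- by apply: measurable_funB; exact: measurable_Lp.
- exact: measurable_sum.
- by move=> x; exact: sumr_ge0.
- apply: filterS2 ut vt' => x /(_ Logic.I) -> /(_ Logic.I) ->.
  exact: powR_switch_dist.
- under eq_integral do rewrite -sumEFin.
  rewrite ge0_integral_sum // => [|k]; last exact/measurable_EFinP.
  by rewrite -sumEFin; apply: lee_sum => k _; exact: integral_heaviside_dist.
Qed.

End LebesgueOn.

(** * Point values and averages of switching functions *)

Lemma Rintegral_sum d (X : measurableType d) (R : realType)
    (m : {measure set X -> \bar R}) (D : set X) (I : finType) (f : I -> X -> R) :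
  measurable D -> (forall i, m.-integrable D (EFin \o f i)) ->
  \int[m]_(x in D) (\sum_i f i x) = \sum_i \int[m]_(x in D) f i x.
Proof.
move=> mD fi; rewrite /Rintegral.
under eq_integral do rewrite -sumEFin.
rewrite (integral_sum mD fi) sum_fine // => i _.
exact: integrable_fin_num (fi i).
Qed.

Section SwitchValues.
Variables (R : realType) (T p : R) (p1 : (1 <= p%:E)%E).
Hypothesis T0 : 0 < T.
Local Notation mu := (lebesgue_on T).
Local Notation Lp := (Lp T p1).

Lemma ae_lebesgue_on_ex (Q : set R) (x y : R) : 0 <= x -> x < y -> y <= T ->
  (\forall z \ae mu, Q z) -> exists2 z, z \in `]x, y[ & Q z.
Proof.
move=> x0 xy yT [N [mN N0 QN]]; apply: contrapT => nQ.
have : (mu `]x, y[%classic <= mu N)%E.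
  apply: le_measure; rewrite ?inE // => z zxy; apply: QN => /= Qz.
  by apply: nQ; exists z.
rewrite N0 leNgt => /negP; apply.
rewrite /lebesgue_on /= /mrestr setIidl; last first.
  by move=> z /=; rewrite !in_itv /= => /andP[? ?]; lra.
by rewrite lebesgue_measure_itv /= lte_fin xy lte_fin subr_gt0.
Qed.

(** If the values differed at [x], right continuity would keep them different on an interval to the
    right of [x], which has positive measure. *)
Lemma right_cont_ae_eq (v w : R -> R) :
  (forall x, x \in `]0, T[ -> v y @[y --> x^'+] --> v x) ->
  (forall x, x \in `]0, T[ -> w y @[y --> x^'+] --> w x) ->
  v = w %[ae mu] -> forall x, x \in `]0, T[ -> v x = w x.
Proof.
move=> vc wc vw x x0T; apply/eqP; rewrite -subr_eq0; apply/negPn/negP => vwx.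
have /cvgr_neq0 /(_ vwx) : v y - w y @[y --> x^'+] --> v x - w x.
  by apply: cvgB; [exact: vc|exact: wc].
move=> [e /= e0 ne].
have := x0T; rewrite in_itv /= => /andP[x0 xT].
have [||y +] := @ae_lebesgue_on_ex _ x (Num.min T (x + e)) (ltW x0) _ _ vw.
- by rewrite lt_min xT ltrDl.
- by rewrite ge_min lexx.
rewrite in_itv /= => /andP[xy]; rewrite lt_min => /andP[yT yxe] vwy.
have := ne y; rewrite /= ltr0_norm ?subr_lt0 // opprB ltrBlDl => /(_ yxe xy).
by rewrite vwy // subrr eqxx.
Qed.

Lemma has_value_switch sigma (t : 'rV[R]_sigma) (u : Lp) s b :
  u = switch t %[ae mu] -> s \in `[0, T[ -> has_value u s b <-> switch t s = b.
Proof.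
move=> ut; rewrite in_itv /= => /andP[s0 sT].
split=> [[v [vc vu]]|<-]; last first.
  exists (switch t).
    by split=> [x _|]; [exact: switch_right_cont|exact: ae_eq_sym].
  by case: eqP => // ->; exact: switch_right_cont.
have vt : forall x, x \in `]0, T[ -> v x = switch t x.
  apply: right_cont_ae_eq => // [x _|]; first exact: switch_right_cont.
  exact: ae_eq_trans vu ut.
case: eqP => [->|/eqP s00 <-]; last first.
  by rewrite vt // in_itv /= sT andbT lt_neqAle eq_sym s00.
(* At time 0 the value is a right limit. Since [v] and [switch t] agree on []0, T[], their right
   limits at 0 coincide, and that of [switch t] is its value at 0. *)
move=> vb; apply: (cvg_unique _ (@switch_right_cont _ _ t 0) _) => //.
apply: cvg_trans vb; apply: near_eq_cvg.
near=> x; rewrite vt // in_itv /=; apply/andP; split.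
  by near: x; exact: nbhs_right_gt.
by near: x; exact: nbhs_right_lt.
Unshelve. all: by end_near. Qed.

Lemma fixed_switch_setP sigma (P : set 'rV[R]_sigma) N (tau : 'I_N -> R)
    (c : 'I_N -> bool) (u : Lp) : (forall j, tau j \in `[0, T[) ->
  fixed_switch_set T p1 P tau c u <->
  exists t, [/\ P t, switch_times t, u = switch t %[ae mu] &
                forall j, switch t (tau j) = (c j)%:R].
Proof.
move=> tau0T; split.
  move=> [[t [Pt tt] ut] uc]; exists t; split=> // j.
  exact: (has_value_switch _ ut (tau0T j)).1.
move=> [t [Pt tt ut tc]]; split; first by exists t.
by move=> j; apply/(has_value_switch _ ut (tau0T j)).
Qed.

(** The projection of [s] onto [[a, b]]; thus [b - clamp a b s] is the length of the part of []a,
    b[] that lies to the right of [s]. *)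
Definition clamp (a b s : R) : R := Num.max a (Num.min b s).

Definition switch_avg sigma M (a b : 'I_M -> R) (t : 'rV[R]_sigma) : 'rV[R]_M :=
  \row_i ((b i - a i)^-1 * \sum_(k < sigma) (-1) ^+ k * (b i - clamp (a i) (b i) (t 0 k))).

Lemma integrable_heaviside (a b s : R) :
  lebesgue_measure.-integrable `]a, b[ (EFin \o heaviside s).
Proof.
apply: measurable_bounded_integrable => //.
- by rewrite /= lebesgue_measure_itv /=; case: ifP => _; rewrite -?EFinB ltry.
- exact: measurable_heaviside.
- exists 1; split => // x x1 y _ /=; apply: le_trans (ltW x1).
  exact: heaviside_norm.
Qed.

Lemma Rintegral_heaviside (a b s : R) : a < b ->
  \int[lebesgue_measure]_(x in `]a, b[) heaviside s x = b - clamp a b s.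
Proof.
move=> ab; rewrite /Rintegral.
under eq_integral do rewrite heaviside_indic.
rewrite integral_indic //= /clamp.
have [sa|sa] := leP s a.
  rewrite (_ : _ `&` _ = `]a, b[%classic).
    by rewrite lebesgue_measure_itv /= lte_fin ab min_r ?(le_trans sa (ltW ab)) // max_l.
  apply/seteqP; split=> x; rewrite /= !in_itv /= ?andbT; first by case.
  by move=> /andP[ax xb]; rewrite ax xb (le_trans sa (ltW ax)).
have [sb|bs] := ltP s b.
  rewrite (_ : _ `&` _ = `[s, b[%classic).
    by rewrite lebesgue_measure_itv /= lte_fin sb max_r // ltW.
  apply/seteqP; split=> x; rewrite /= !in_itv /= ?andbT; first by case=> -> /andP[].
  by move=> /andP[sx xb]; rewrite sx xb (lt_le_trans sa sx).
rewrite (_ : _ `&` _ = set0).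
  by rewrite measure0 max_r ?(ltW ab) // subrr.
apply/seteqP; split=> x //=; rewrite /= !in_itv /= ?andbT => -[sx /andP[_ xb]].
by have := le_lt_trans (le_trans bs sx) xb; rewrite ltxx.
Qed.

Lemma Rintegral_switch sigma (t : 'rV[R]_sigma) (a b : R) : switch_times t -> a < b ->
  \int[lebesgue_measure]_(x in `]a, b[) switch t x =
  \sum_(k < sigma) (-1) ^+ k * (b - clamp a b (t 0 k)).
Proof.
move=> tt ab; rewrite switchE //.
have ih (k : 'I_sigma) : lebesgue_measure.-integrable `]a, b[
    (EFin \o (fun x => (-1) ^+ k * heaviside (t 0 k) x)).
  rewrite (_ : _ \o _ = (fun x => ((-1) ^+ k)%:E * (heaviside (t 0 k) x)%:E)%E) //.
  by apply: integrableZl => //; exact: integrable_heaviside.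
rewrite Rintegral_sum //; apply: eq_bigr => k _.
rewrite RintegralZl ?Rintegral_heaviside //; exact: integrable_heaviside.
Qed.

Lemma local_avg_switch sigma M (a b : 'I_M -> R) (t : 'rV[R]_sigma) (u : Lp) :
  (forall i, a i < b i) -> (forall i, `]a i, b i[%classic `<=` `]0, T[%classic) ->
  switch_times t -> u = switch t %[ae mu] -> local_avg a b u = switch_avg a b t.
Proof.
move=> ab abT tt ut; apply/rowP => i; rewrite !mxE -Rintegral_switch //.
congr (_ * _); rewrite !(Rintegral_lebesgue_on _ (abT i)); congr fine.
apply: ae_eq_integral => //.
- apply/measurable_EFinP/(measurable_funS measurableT) => //; exact: measurable_Lp.
- apply/measurable_EFinP; exact: measurable_switch.
- by apply: filterS ut => x + _ => /(_ Logic.I) ->.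
Qed.

End SwitchValues.

(** * Cells of switching times *)

Section Cells.
Variables (R : realType) (sigma N : nat) (P : set 'rV[R]_sigma) (tau : 'I_N -> R).
Implicit Types (t q : 'rV[R]_sigma) (e : {ffun 'I_N * 'I_sigma -> bool}).

(* [e (j, i)] prescribes whether the [i]-th switching happens no later than [tau j];
   on such a cell all the values [switch t (tau j)] are constant. *)
Definition open_cell e : set 'rV[R]_sigma :=
  [set t | [/\ P t, switch_times t & forall j i, (t 0 i <= tau j) = e (j, i)]].

Definition closed_cell e : set 'rV[R]_sigma :=
  [set t | [/\ P t, switch_times t &
    forall j i, if e (j, i) then t 0 i <= tau j else tau j <= t 0 i]].

Lemma open_cell_closed e : open_cell e `<=` closed_cell e.
Proof.
move=> t [Pt tt te]; split=> // j i; rewrite -te; case: ifP => // /negbT.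
by rewrite -ltNge => /ltW.
Qed.

Lemma switch_open_cell e t j : open_cell e t ->
  switch t (tau j) = (odd #|[pred i | e (j, i)]|)%:R.
Proof.
move=> [_ _ te]; rewrite /switch; congr (odd _)%:R.
by apply: eq_card => i; rewrite !inE te.
Qed.

Lemma scalar_coord i : scalar (fun t => t 0 i).
Proof. by move=> s x y; rewrite !mxE. Qed.

Lemma polytope_closed_cell e : polytope P -> (forall t, P t -> forall i, 0 <= t 0 i) ->
  polytope (closed_cell e).
Proof.
move=> pP P0.
(* Pairs out of order get the zero functional, whose constraint is vacuous, so that all pairs can
   serve as indices. In [l'] and [d'] the sign turns lower bounds into upper bounds. *)
pose l (ij : 'I_sigma * 'I_sigma) t :=
  if (ij.1 <= ij.2)%N then t 0 ij.1 - t 0 ij.2 else 0.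
pose l' (ji : 'I_N * 'I_sigma) t := if e ji then t 0 ji.2 else - t 0 ji.2.
pose d' (ji : 'I_N * 'I_sigma) := if e ji then tau ji.1 else - tau ji.1.
have -> : closed_cell e = (P `&` [set t | forall ij, l ij t <= 0])
    `&` [set t | forall ji, l' ji t <= d' ji].
  apply/seteqP; split=> [t [Pt [_ tm] te]|t [[Pt tm] te]].
    split; [split=> // -[i j]; rewrite /l /=|move=> [j i]; rewrite /l' /d' /=].
      by case: ifP => // ij; rewrite subr_le0 tm.
    by have := te j i; case: ifP => // _; rewrite lerN2.
  split=> // [|j i]; first split=> [|i j ij]; first exact: P0.
    by have := tm (i, j); rewrite /l /= ij subr_le0.
  by have := te (j, i); rewrite /l' /d' /=; case: ifP => // _; rewrite lerN2.
apply: polytope_halfspaces => [[j i] s x y|].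
  by rewrite /l' /=; case: ifP => _; rewrite !mxE //; ring.
apply: polytope_halfspaces => // -[i j] s x y.
by rewrite /l /=; case: ifP => _; rewrite ?mxE; ring.
Qed.

(** The positive weight on [q] preserves the strict inequalities of the open cell, while [t]
    contributes at worst equalities. *)
Lemma open_cell_segment e q t s : polytope P -> open_cell e q -> closed_cell e t ->
  0 < s -> s <= 1 -> open_cell e (s *: q + (1 - s) *: t).
Proof.
move=> [S _ PE] [Pq [q0 qm] qe] [Pt [t0 tm] te] s0 s1; split.
- have /convex_setP cP : @convex_set R _ P by rewrite PE; exact: conv_hull_convex.
  exact: cP (ltW s0) s1.
- split=> [i|i j ij]; rewrite !mxE.
    by rewrite addr_ge0 // mulr_ge0 ?subr_ge0 // ltW.
  by rewrite lerD // ler_wpM2l ?subr_ge0 ?qm ?tm // ltW.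
- move=> j i; rewrite !mxE; have := te j i; have := qe j i; case: (e _).
    by move=> hq ht; apply/idP; nra.
  by move=> /negbT; rewrite -ltNge => hq ht; apply/negbTE; rewrite -ltNge; nra.
Qed.

End Cells.

(** The cutting hyperplanes are the breakpoints [t_k = a_i] and [t_k = b_i] of the clamps. On a
    piece lying on one side of each of them, every clamp is constantly [a_i], constantly [b_i], or
    the coordinate itself. *)
Lemma switch_avg_fin_hulled (R : realType) sigma M (a b : 'I_M -> R)
    (A : set 'rV[R]_sigma) : (forall i, a i < b i) -> polytope A ->
  fin_hulled (switch_avg a b) A.
Proof.
move=> ab pA.
pose r : seq (('rV[R]_sigma -> R) * R) :=
  [seq (fun t : 'rV[R]_sigma => t 0 ki.1, a ki.2) | ki : 'I_sigma * 'I_M] ++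
  [seq (fun t : 'rV[R]_sigma => t 0 ki.1, b ki.2) | ki : 'I_sigma * 'I_M].
apply: (@fin_hulled_piecewise _ _ _ r) => // [h|B pB BA hB].
  by rewrite mem_cat => /orP[] /mapP[ki _ ->] /=; exact: scalar_coord.
have [S _ BE] := pB.
have /convex_setP cB : @convex_set R _ B by rewrite BE; exact: conv_hull_convex.
have clamp_affine k i x y s : B x -> B y -> 0 <= s -> s <= 1 ->
    clamp (a i) (b i) (s * x 0 k + (1 - s) * y 0 k) =
    s * clamp (a i) (b i) (x 0 k) + (1 - s) * clamp (a i) (b i) (y 0 k).
  move=> Bx By s0 s1; have abi := ab i.
  have -> : s * x 0 k + (1 - s) * y 0 k = (s *: x + (1 - s) *: y) 0 k by rewrite !mxE.
  have Bxy := cB _ _ _ Bx By s0 s1.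
  have ha : (forall z, B z -> z 0 k <= a i) \/ (forall z, B z -> a i <= z 0 k).
    apply: (hB (fun t : 'rV[R]_sigma => t 0 k, a i)).
    by rewrite mem_cat; apply/orP; left; apply/mapP; exists (k, i); rewrite ?mem_enum.
  have hb : (forall z, B z -> z 0 k <= b i) \/ (forall z, B z -> b i <= z 0 k).
    apply: (hB (fun t : 'rV[R]_sigma => t 0 k, b i)).
    by rewrite mem_cat; apply/orP; right; apply/mapP; exists (k, i); rewrite ?mem_enum.
  case: ha => ha.
    have ca z : B z -> clamp (a i) (b i) (z 0 k) = a i.
      by move=> /ha za; rewrite /clamp min_r ?max_l // (le_trans za) // ltW.
    by rewrite !ca //; ring.
  case: hb => hb.
    have cz z : B z -> clamp (a i) (b i) (z 0 k) = z 0 k.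
      by move=> Bz; rewrite /clamp min_r ?max_r ?ha // hb.
    by rewrite !cz // !mxE.
  have cb z : B z -> clamp (a i) (b i) (z 0 k) = b i.
    by move=> /hb bz; rewrite /clamp min_l // max_r // ltW.
  by rewrite !cb //; ring.
move=> x y s Bx By s0 s1; apply/rowP => i; rewrite !mxE.
rewrite !mulrA ![_ * (b i - a i)^-1]mulrC -!mulrA -mulrDr; congr (_ * _).
rewrite !mulr_sumr -big_split /=; apply: eq_bigr => k _.
by rewrite !mxE clamp_affine //; ring.
Qed.

(** * Closed cells and the closure in L^p *)

Section Closure.
Variables (R : realType) (T p : R) (p1 : (1 <= p%:E)%E).
Hypothesis T0 : 0 < T.
Variables (sigma : nat) (P : set 'rV[R]_sigma) (N : nat) (tau : 'I_N -> R)
  (c : 'I_N -> bool).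
Hypotheses (pP : polytope P) (tau0T : forall j, tau j \in `[0, T[).
Local Notation mu := (lebesgue_on T).
Local Notation D_SP := (fixed_switch_set T p1 P tau c).

(** The parities decide the values at all the fixings. Nonemptiness of the open cell is asked
    because a closed cell can be nonempty while its open cell is empty, and then its points need not
    be limits of admissible functions. *)
Definition feasible : set {ffun 'I_N * 'I_sigma -> bool} :=
  [set e : {ffun 'I_N * 'I_sigma -> bool} |
    (forall j, odd #|[pred i | e (j, i)]| = c j) /\ open_cell P tau e !=set0].

Lemma fixed_switch_open_cell (u : Lp T p1) : D_SP u ->
  exists t e, [/\ feasible e, open_cell P tau e t, switch_times t &
                  u = switch t %[ae mu]].
Proof.
move=> /(fixed_switch_setP T0 _ _ _ tau0T) [t [Pt tt ut tc]].
pose e := [ffun ji : 'I_N * 'I_sigma => t 0 ji.2 <= tau ji.1].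
have te : open_cell P tau e t by split=> // j i; rewrite ffunE.
exists t, e; split=> //; split=> [j|]; last by exists t.
have := tc j; rewrite (switch_open_cell j te) => /eqP.
by rewrite eqr_nat; case: (odd _); case: (c j).
Qed.

(** Moving [t] slightly towards a point [q] of the open cell yields admissible switching times whose
    function is close in L^p. *)
Lemma closed_cell_Lp_closure e t (u : Lp T p1) :
  feasible e -> closed_cell P tau e t -> u = switch t %[ae mu] ->
  Lp_closure D_SP u.
Proof.
move=> [ec [q qe]] te ut eps eps0.
have p0 : 0 < p by rewrite (lt_le_trans ltr01) // -lee_fin.
pose Q := \sum_k `|t 0 k - q 0 k|.
have Q0 : 0 <= Q by exact: sumr_ge0.
have ep0 : 0 < eps `^ p by exact: powR_gt0.
(* The moved point is at distance [s * Q] from [t], which has to stay below [eps] to the power [p].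
   Dividing by [Q + 1] covers [Q = 0], and the minimum with 1 keeps [s] a convex weight. *)
pose s := Num.min 1 (eps `^ p / (Q + 1)).
have s1 : s <= 1 by rewrite /s ge_min lexx.
have s0 : 0 < s by rewrite lt_min ltr01 divr_gt0 // ltr_wpDl.
have sQ : s * Q < eps `^ p.
  have : s <= eps `^ p / (Q + 1) by rewrite /s ge_min lexx orbT.
  by rewrite ler_pdivlMr ?ltr_wpDl // => h; nra.
pose t' := s *: q + (1 - s) *: t.
have t'e : open_cell P tau e t' by exact: open_cell_segment.
have [_ tt _] := te; have [Pt' tt' _] := t'e.
have [v vt'] := Lp_ae_ex p1 T0 (@measurable_switch _ _ _ setT tt') (switch_norm t').
exists v.
  apply/fixed_switch_setP => //; exists t'; split=> // j.
  by rewrite (switch_open_cell j t'e) ec.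
apply: (le_lt_trans (Lp_dist_switch tt tt' ut vt')); rewrite lte_fin.
have -> : \sum_k `|t 0 k - t' 0 k| = s * Q.
  rewrite mulr_sumr; apply: eq_bigr => k _; rewrite !mxE.
  rewrite -[X in X * `|_|](gtr0_norm s0) -normrM; congr `|_|; ring.
(* [eps] is written as its p-th power raised to [1/p], so that strict monotonicity of the root
   reduces the goal to [sQ]. *)
rewrite -[ltRHS](@powRr1 _ eps) ?ltW // -(@mulfV _ p) ?gt_eqF // powRrM.
rewrite gt0_ltr_powR ?invr_gt0 ?nnegrE ?mulr_ge0 // ?ltW //.
Qed.

End Closure.

Theorem theorem4p6 (R : realType) (T p : R) (p1 : (1 <= p%:E)%E)
    (sigma : nat) (P : set 'rV[R]_sigma)
    (N : nat) (tau : 'I_N -> R) (c : 'I_N -> bool)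
    (M : nat) (a b : 'I_M -> R) :
  0 < T ->
  polytope P ->
  (forall t, P t -> forall i, 0 <= t 0 i) ->
  (forall j, tau j \in `[0, T[) ->
  (forall j k : 'I_N, (j < k)%N -> tau j < tau k) ->
  (forall i, a i < b i) ->
  (forall i, `]a i, b i[%classic `<=` `]0, T[%classic) ->
  trivIset setT (fun i => `]a i, b i[%classic) ->
  (forall i j, tau j \notin `]a i, b i[) ->
  polytope (conv_hull
    [set local_avg a b u | u in Lp_closure (fixed_switch_set T p1 P tau c)]).
Proof.
move=> T0 pP P0 tau0T _ ab abT _ _.
have [S [fS SK] KS] : fin_hulled (switch_avg a b)
    (\bigcup_(e in feasible P tau c) closed_cell P tau e).
  apply: fin_hulled_bigcup => e _; apply: switch_avg_fin_hulled => //.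
  exact: polytope_closed_cell.
exists (switch_avg a b @` S); first exact: finite_image.
apply/seteqP; split; apply: conv_hull_mono => y [].
  move=> u uc <-; apply: conv_hull_finite_closed; first exact: finite_image.
  move=> eps eps0; have [C C0 CP] := Rintegral_Lp_dist p1 T0.
  (* [W] dominates every normalising factor [(b i - a i)^-1]; an L^p error below [eps / (C * W)]
     therefore moves each average by less than [eps]. *)
  pose W := 1 + \sum_i (b i - a i)^-1.
  have inv0 i : 0 < (b i - a i)^-1 by rewrite invr_gt0 subr_gt0.
  have W0 : 0 < W by rewrite ltr_wpDr // sumr_ge0 // => i _; exact: ltW.
  have [v vD uv] := uc (eps / (C * W)) (divr_gt0 eps0 (mulr_gt0 C0 W0)).
  have [t [e [fe te tt vt]]] := fixed_switch_open_cell T0 tau0T vD.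
  exists (local_avg a b v).
    rewrite (local_avg_switch ab abT tt vt); apply: KS; exists t => //.
    by exists e => //; exact: open_cell_closed.
  move=> i; rewrite !mxE -mulrBr normrM (gtr0_norm (inv0 i)).
  set X := `|_ - _|; have X_lt : X < eps / W.
    rewrite -lte_fin; apply: le_lt_trans (CP u v _ (measurable_itv _) (abT i)) _.
    have -> : eps / W = C * (eps / (C * W)) by field; rewrite !gt_eqF.
    by rewrite EFinM lte_pmul2l // lte_fin.
  apply: (@le_lt_trans _ _ (W * X)); last by rewrite mulrC -ltr_pdivlMr.
  apply: ler_wpM2r; first exact: normr_ge0.
  rewrite /W (bigD1 i) //= addrCA lerDl addr_ge0 // sumr_ge0 // => k _.
  exact: ltW.
move=> t St <-; apply: conv_hull_sub.
(* The spanning points belong to closed cells of feasible patterns, so each is the average vector of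
   an element of the closure. *)
have [e fe te] := SK _ St; have [_ tt _] := te.
have [u ut] := Lp_ae_ex p1 T0 (@measurable_switch _ _ _ setT tt) (switch_norm t).
exists u; last exact: local_avg_switch.
exact: (closed_cell_Lp_closure T0 pP tau0T fe te ut).
Qed.
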